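(* Let $\mathbb{F}$ be a linearly ordered field. For any input $(\mathsf{P},\mathsf{f})$ defined over $\mathbb{F}$, where $\mathsf{P}=(A,b)$ represents $P=\{x\in\mathbb{F}^{n}:Ax\le b\}$ and $\mathsf{f}=(Q,c,\gamma)$ represents $f(x)=x^{T}Qx+c^{T}x+\gamma$, the algorithm MinQP_LOF (described in the context) terminates in a finite number of steps and returns: 1. status Infeasible if and only if $P=\emptyset$; 2. status Unbounded if and only if $f$ is unbounded from below on $P$; 3. status Optimal and a point $x^{*}\in P$ if and only if a global minimum of $f$ on $P$ exists, in which case $f(x^{*})\le f(x)$ for all $x\in P$.
   Context: A linearly ordered field is a field with a total order compatible with addition and multiplication. The model of computation is Blum--Shub--Smale: arithmetic operations and order comparisons in $\mathbb{F}$ are primitive unit-cost instructions. Input: $\mathsf{P}=(A,b)$ with $A\in\mathbb{F}^{m\times n}$, $b\in\mathbb{F}^{m}$, $n\ge 1$ (zero rows of $A$ are allowed), and $\mathsf{f}=(Q,c,\gamma)$ with $Q\in\mathbb{F}^{n\times n}$ symmetric, $c\in\mathbb{F}^{n}$, $\gamma\in\mathbb{F}$. ''Unbounded from below on $P$'' means that for every $\nu\in\mathbb{F}$ there is $x\in P$ with $f(x)<\nu$. Output: a triplet (Status, Value, Point), which is (Infeasible, $\infty$, null), or (Unbounded, $-\infty$, null), or (Optimal, value, point). Decoupled diagonal form: for every such $f$ one can compute, by finitely many field operations (Lagrange diagonalization and completing squares), a non-singular $S\in\mathbb{F}^{n\times n}$, a diagonal $\Lambda\in\mathbb{F}^{n\times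 n}$, vectors $u,v\in\mathbb{F}^{n}$ and $\gamma'\in\mathbb{F}$ with $f(x)=(x-v)^{T}S^{T}\Lambda S(x-v)+u^{T}S(x-v)+\gamma'$ and $\Lambda u=\mathbf{0}$. $\Lambda\succeq 0$ means that all diagonal entries of $\Lambda$ are $\ge 0$. Algorithm MinQP_LOF$(\mathsf{P},\mathsf{f})$: Step 0 (zero rows). For each row $a_i=\mathbf{0}$ of $A$: if $b_i<0$, return (Infeasible, $\infty$, null); otherwise remove constraint $i$ from $\mathsf{P}$. Step 1 (base case). If $n=1$, solve the univariate quadratic problem over the feasible interval directly (by finitely many field operations and comparisons) and return its status, its minimum value and a minimizer (with the conventions above). Step 2 (diagonalization). Compute a decoupled diagonal form of $f$ and apply the change of coordinates $y=S(x-v)$ to $\mathsf{P}$ and $\mathsf{f}$; from now on $(A,b)$ denotes the system of constraints in the $y$-coordinates and $f(y)=y^{T}\Lambda y+u^{T}y+\gamma'$. Step 3 (global optimality check). If $\Lambda\succeq 0$, $u=\mathbf{0}$ and $\mathbf{0}\le b$, return (Optimal, $\gamma'$, $v$). Step 4 (branching). Set $\mathcal{S}=\emptyset$. For each $h\in\{-1,1\}^{n}$, let $\mathsf{P}^{h}$ be the system consisting of $Ay\le b$ together with $\mathrm{diag}(h)\,y\le\mathbf{0}$. For each inequality $a_k^{T}y\le b_k$ of $\mathsf{P}^{h}$: compute $M\in\mathbb{F}^{n\times(n-1)}$ and $p\in\mathbb{F}^{n}$ such that $z\mapsto Mz+p$, $z\in\mathbb{F}^{n-1}$, parameterizes the hyperplane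 $a_k^{T}y=b_k$; let $(\mathsf{P}',\mathsf{f}')$ be obtained by substituting $y=Mz+p$ into $\mathsf{f}$ and into the remaining constraints of $\mathsf{P}^{h}$; call recursively $(stat,val,z^{*})=$ MinQP_LOF$(\mathsf{P}',\mathsf{f}')$. If $stat$ is Unbounded, return (Unbounded, $-\infty$, null). If $stat$ is Optimal, add $(val,Mz^{*}+p)$ to $\mathcal{S}$. Step 5 (selection). If $\mathcal{S}=\emptyset$, return (Infeasible, $\infty$, null). Otherwise choose $(val^{*},y^{*})\in\mathcal{S}$ with minimum $val^{*}$ and return (Optimal, $val^{*}$, $S^{-1}y^{*}+v$). *)

(* Defs.v *)
From HB Require Import structures.
From mathcomp Require Import all_boot all_order all_algebra.
From Stdlib Require Export Relation_Operators.

Set Implicit Arguments.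
Unset Strict Implicit.
Unset Printing Implicit Defensive.

Import Order.TTheory GRing.Theory Num.Theory.
Local Open Scope ring_scope.

Section MinQP.
Context {F : realFieldType}.

(* The pair (a, beta) stands for the inequality a x <= beta. *)
Definition ineq (n : nat) : Type := ('rV[F]_n * F)%type.
Definition system (n : nat) : Type := seq (ineq n).

Record quad (n : nat) : Type :=
  Quad { qmat : 'M[F]_n; qlin : 'cV[F]_n; qcst : F }.

Definition qeval n (f : quad n) (x : 'cV[F]_n) : F :=
  (x^T *m qmat f *m x) 0 0 + ((qlin f)^T *m x) 0 0 + qcst f.

Definition polyhedron m n (A : 'M[F]_(m, n)) (b : 'cV[F]_m) (x : 'cV[F]_n) :
    Prop :=
  forall i, (A *m x) i 0 <= b i 0.

Definition system_of m n (A : 'M[F]_(m, n)) (b : 'cV[F]_m) : system n :=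
  [seq (row i A, b i 0) | i <- enum 'I_m].

Definition feasible n (P : system n) (x : 'cV[F]_n) : Prop :=
  all (fun q : ineq n => (q.1 *m x) 0 0 <= q.2) P.

Definition is_empty n (P : 'cV[F]_n -> Prop) : Prop := forall x, ~ P x.

Definition unbounded_below n (f : 'cV[F]_n -> F) (P : 'cV[F]_n -> Prop) :
    Prop :=
  forall nu : F, exists2 x, P x & f x < nu.

Definition global_min n (f : 'cV[F]_n -> F) (P : 'cV[F]_n -> Prop)
    (x : 'cV[F]_n) : Prop :=
  P x /\ forall y, P y -> f x <= f y.

(* The three shapes of an output triplet: the value +oo (resp. -oo) and the
   null point of the first two carry no information and are left implicit. *)
Inductive output (n : nat) : Type :=
| Infeasible
| Unbounded
| Optimal (val : F) (pt : 'cV[F]_n).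

(* Elements of F obtained from the data D (and the constant 1) by finitely
   many field operations: the only ones that a run on the data D can compute,
   whatever comparisons it makes. *)
Inductive generated (D : F -> Prop) : F -> Prop :=
| gen_data x : D x -> generated D x
| gen_one : generated D 1
| gen_add x y : generated D x -> generated D y -> generated D (x + y)
| gen_opp x : generated D x -> generated D (- x)
| gen_mul x y : generated D x -> generated D y -> generated D (x * y)
| gen_inv x : x != 0 -> generated D x -> generated D x^-1.

Definition mx_generated (D : F -> Prop) m n (A : 'M[F]_(m, n)) : Prop :=
  forall i j, generated D (A i j).

Definition entries m n (A : 'M[F]_(m, n)) (x : F) : Prop :=
  exists i j, x = A i j.

Definition ineq_data n (q : ineq n) (x : F) : Prop :=
  entries q.1 x \/ x = q.2.

Definition system_data n (P : system n) (x : F) : Prop :=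
  exists k, (k < size P)%N /\ ineq_data (nth (0, 0) P k) x.

Definition quad_data n (f : quad n) (x : F) : Prop :=
  [\/ entries (qmat f) x, entries (qlin f) x | x = qcst f].

(* Substitution of x = M z + p. *)
Definition subst_system n k (M : 'M[F]_(n, k)) (p : 'cV[F]_n) (P : system n) :
    system k :=
  [seq (q.1 *m M, q.2 - (q.1 *m p) 0 0) | q : ineq n <- P].

Definition subst_quad n k (M : 'M[F]_(n, k)) (p : 'cV[F]_n) (f : quad n) :
    quad k :=
  Quad (M^T *m qmat f *m M)
       (M^T *m ((qmat f + (qmat f)^T) *m p + qlin f))
       (qeval f p).

Definition zero_row n (q : ineq n) : bool := q.1 == 0.

(* The answers allowed in the base case. *)
Definition solves n (P : system n) (f : quad n) (out : output n) : Prop :=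
  match out with
  | Infeasible => is_empty (feasible P)
  | Unbounded => unbounded_below (qeval f) (feasible P)
  | Optimal val x =>
      let D := fun t => system_data P t \/ quad_data f t in
      [/\ global_min (qeval f) (feasible P) x, val = qeval f x,
          generated D val & mx_generated D x]
  end.

Definition decoupled_form n (f : quad n) (S L : 'M[F]_n) (u v : 'cV[F]_n)
    (g : F) : Prop :=
  [/\ S \in unitmx, is_diag_mx L, L *m u = 0 &
      forall x, qeval f x =
        ((x - v)^T *m S^T *m L *m S *m (x - v)) 0 0
        + (u^T *m S *m (x - v)) 0 0 + g].

Definition parameterizes n k (M : 'M[F]_(n, k)) (p : 'cV[F]_n) (q : ineq n) :
    Prop :=
  injective (fun z : 'cV[F]_k => M *m z + p) /\
  forall y : 'cV[F]_n, (q.1 *m y) 0 0 = q.2 <-> exists z, y = M *m z + p.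

(* diag(h) y <= 0, where h i = true encodes h_i = -1. *)
Definition orthant n (h : {ffun 'I_n -> bool}) : system n :=
  [seq ((-1) ^+ h i *: delta_mx 0 i, 0) | i <- enum 'I_n].

(* A branch is an inequality of P^h together with the remaining ones. *)
Definition branch (n : nat) : Type := (ineq n * system n)%type.

Definition facets n (P : system n) : seq (branch n) :=
  [seq (nth (0, 0) P k, take k P ++ drop k.+1 P) | k <- iota 0 (size P)].

Definition branches n (P : system n) : seq (branch n) :=
  flatten [seq facets (P ++ orthant h) | h <- enum {: {ffun 'I_n -> bool}}].

(* States of a run of MinQP_LOF on an n-dimensional input, one constructor per
   program point.  From Step3 on, P and f are in the coordinates
   y = S (x - v); [todo] lists the branches still to be explored and [found]
   is the set of pairs (val, M z + p) collected so far.  Step4rec is the state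
   in which the recursive call has reached the state [sub]. *)
Inductive config (n : nat) : Type :=
| Step0 (P : system n) (f : quad n)
| Step1 (P : system n) (f : quad n)
| Step2 (P : system n) (f : quad n)
| Step3 (S : 'M[F]_n) (v : 'cV[F]_n) (P : system n) (f : quad n)
| Step4 (S : 'M[F]_n) (v : 'cV[F]_n) (f : quad n)
    (todo : seq (branch n)) (found : seq (F * 'cV[F]_n))
| Step4rec (S : 'M[F]_n) (v : 'cV[F]_n) (f : quad n)
    (todo : seq (branch n)) (found : seq (F * 'cV[F]_n))
    (M : 'M[F]_(n, n.-1)) (p : 'cV[F]_n) (sub : config n.-1)
| Step5 (S : 'M[F]_n) (v : 'cV[F]_n) (found : seq (F * 'cV[F]_n))
| Return (out : output n).

Definition globally_solved n (P : system n) (f : quad n) : bool :=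
  [&& [forall i, 0 <= qmat f i i], qlin f == 0
    & all (fun q : ineq n => 0 <= q.2) P].

(* The relation is non-deterministic: it allows every decoupled form, every
   parameterization, every order of exploration of the branches, every
   minimizer in the base case and every choice in the final selection. *)
Inductive step (n : nat) : config n -> config n -> Prop :=
| step0_infeasible P f :
    has (fun q : ineq n => zero_row q && (q.2 < 0)) P ->
    step (Step0 P f) (Return (Infeasible n))
| step0_remove P f :
    ~~ has (fun q : ineq n => zero_row q && (q.2 < 0)) P ->
    step (Step0 P f) (Step1 [seq q <- P | ~~ zero_row q] f)
| step1_base P f out :
    n = 1%N -> solves P f out -> step (Step1 P f) (Return out)
| step1_skip P f :
    n <> 1%N -> step (Step1 P f) (Step2 P f)
| step2_diagonalize P f S L u v g :
    decoupled_form f S L u v g ->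
    mx_generated (quad_data f) S -> mx_generated (quad_data f) L ->
    mx_generated (quad_data f) u -> mx_generated (quad_data f) v ->
    generated (quad_data f) g ->
    step (Step2 P f)
         (Step3 S v (subst_system (invmx S) v P) (Quad L u g))
| step3_optimal S v P f :
    globally_solved P f ->
    step (Step3 S v P f) (Return (Optimal (qcst f) v))
| step3_branch S v P f :
    ~~ globally_solved P f ->
    step (Step3 S v P f) (Step4 S v f (branches P) [::])
| step4_call S v f todo1 q P todo2 found M p :
    parameterizes M p q ->
    mx_generated (ineq_data q) M -> mx_generated (ineq_data q) p ->
    step (Step4 S v f (todo1 ++ (q, P) :: todo2) found)
         (Step4rec S v f (todo1 ++ todo2) found M p
            (Step0 (subst_system M p P) (subst_quad M p f)))
| step4_run S v f todo found M p (sub sub' : config n.-1) :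
    step sub sub' ->
    step (Step4rec S v f todo found M p sub)
         (Step4rec S v f todo found M p sub')
| step4_infeasible S v f todo found M p :
    step (Step4rec S v f todo found M p (Return (Infeasible n.-1)))
         (Step4 S v f todo found)
| step4_unbounded S v f todo found M p :
    step (Step4rec S v f todo found M p (Return (Unbounded n.-1)))
         (Return (Unbounded n))
| step4_optimal S v f todo found M p val z :
    step (Step4rec S v f todo found M p (Return (Optimal val z)))
         (Step4 S v f todo ((val, M *m z + p) :: found))
| step4_end S v f found :
    step (Step4 S v f [::] found) (Step5 S v found)
| step5_infeasible S v :
    step (Step5 S v [::]) (Return (Infeasible n))
| step5_select S v found val y :
    (val, y) \in found ->
    all (fun r : F * 'cV[F]_n => val <= r.1) found ->
    step (Step5 S v found) (Return (Optimal val (invmx S *m y + v))).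

Definition reachable n : config n -> config n -> Prop :=
  clos_refl_trans (config n) (@step n).

Definition MinQP_LOF m n (A : 'M[F]_(m, n)) (b : 'cV[F]_m) (f : quad n) :
    config n :=
  Step0 (system_of A b) f.

Definition returns n (s : config n) (out : output n) : Prop :=
  reachable s (Return out).

(* No infinite run from s, and no run from s gets stuck before returning. *)
Definition terminates n (s : config n) : Prop :=
  Acc (fun t' t => step t t') s /\
  forall t, reachable s t ->
    (exists out, t = Return out) \/ (exists t', step t t').

End MinQP.

(* Main.v *)
(* If the unconstrained optimality check fails, every feasible x is dominated by
   a point y of some facet of some P^h, i.e. f y <= f x.  Either f decreases
   along the segment from x to 0, which is infeasible, so that a constraint
   becomes tight on the way; or f decreases to -oo along a coordinate direction d.
   In the second case the ray from x along d either hits a constraint, or d is a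
   recession direction of P^h; then, since P^h lies in an orthant, moving x along
   another coordinate axis makes some constraint parallel to d tight, and points
   far along d on its facet are feasible and have arbitrarily small values.
   Hence the infimum of f over P is the least of those over the finitely many
   branches, and induction on the dimension shows that each of these is empty,
   unbounded or attains its minimum. *)
Require Import Defs.
From Stdlib Require Import Operators_Properties.
From mathcomp Require Import all_boot all_order all_algebra.
From mathcomp Require Import ring lra.

Set Implicit Arguments.
Unset Strict Implicit.
Unset Printing Implicit Defensive.

Import Order.TTheory GRing.Theory Num.Theory.
Local Open Scope ring_scope.

(** * Closure of generated elements under field and matrix operations *)

Section Generated.
Context {F : realFieldType}.
Variable D : F -> Prop.

Lemma generated0 : generated D 0.
Proof. by rewrite -(subrr 1); apply: gen_add; [|apply: gen_opp]; apply: gen_one. Qed.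

(** At [x = 0] the convention [0^-1 = 0] replaces [gen_inv]. *)
Lemma generatedV x : generated D x -> generated D x^-1.
Proof.
have [->|x0] := eqVneq x 0; first by rewrite invr0.
exact: gen_inv.
Qed.

Lemma generated_sum I (r : seq I) (E : I -> F) :
  (forall i, generated D (E i)) -> generated D (\sum_(i <- r) E i).
Proof.
by move=> H; apply: (big_ind (generated D)) => //; [apply: generated0|apply: gen_add].
Qed.

Lemma generated_prod I (r : seq I) (E : I -> F) :
  (forall i, generated D (E i)) -> generated D (\prod_(i <- r) E i).
Proof.
by move=> H; apply: (big_ind (generated D)) => //; [apply: gen_one|apply: gen_mul].
Qed.

Lemma generated_nat k : generated D k%:R.
Proof.
by elim: k => [|k IH]; [apply: generated0|rewrite mulrSr; apply: gen_add => //; apply: gen_one].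
Qed.

Lemma generated_sign k : generated D ((-1) ^+ k).
Proof.
by rewrite -signr_odd; case: odd; [apply: gen_opp|]; apply: gen_one.
Qed.

Lemma mx_generatedM m n k (A : 'M[F]_(m, n)) (B : 'M[F]_(n, k)) :
  mx_generated D A -> mx_generated D B -> mx_generated D (A *m B).
Proof. by move=> hA hB i j; rewrite mxE; apply: generated_sum => l; apply: gen_mul. Qed.

Lemma mx_generatedD m n (A B : 'M[F]_(m, n)) :
  mx_generated D A -> mx_generated D B -> mx_generated D (A + B).
Proof. by move=> hA hB i j; rewrite mxE; apply: gen_add. Qed.

Lemma mx_generatedN m n (A : 'M[F]_(m, n)) :
  mx_generated D A -> mx_generated D (- A).
Proof. by move=> hA i j; rewrite mxE; apply: gen_opp. Qed.

Lemma mx_generatedZ m n a (A : 'M[F]_(m, n)) :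
  generated D a -> mx_generated D A -> mx_generated D (a *: A).
Proof. by move=> ha hA i j; rewrite mxE; apply: gen_mul. Qed.

Lemma mx_generated_tr m n (A : 'M[F]_(m, n)) :
  mx_generated D A -> mx_generated D A^T.
Proof. by move=> hA i j; rewrite mxE. Qed.

Lemma mx_generated0 m n : mx_generated D (0 : 'M[F]_(m, n)).
Proof. by move=> i j; rewrite mxE; apply: generated0. Qed.

Lemma mx_generated1 n : mx_generated D (1%:M : 'M[F]_n).
Proof. by move=> i j; rewrite mxE; apply: generated_nat. Qed.

Lemma mx_generated_delta m n i j : mx_generated D (delta_mx i j : 'M[F]_(m, n)).
Proof. by move=> k l; rewrite mxE; apply: generated_nat. Qed.

Lemma mx_generated_block m1 m2 n1 n2 (A : 'M[F]_(m1, n1)) (B : 'M[F]_(m1, n2))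
    (C : 'M[F]_(m2, n1)) (E : 'M[F]_(m2, n2)) :
  mx_generated D A -> mx_generated D B -> mx_generated D C ->
  mx_generated D E -> mx_generated D (block_mx A B C E).
Proof.
move=> hA hB hC hE i j; rewrite !mxE.
by case: split => k; rewrite mxE; case: split.
Qed.

Lemma generated_det n (A : 'M[F]_n) : mx_generated D A -> generated D (\det A).
Proof.
move=> hA; apply: generated_sum => s.
by apply: gen_mul; [apply: generated_sign|apply: generated_prod].
Qed.

(** Cramer's rule: the inverse is the adjugate divided by the determinant. On singular matrices
    [invmx] is the identity map. *)
Lemma mx_generated_inv n (A : 'M[F]_n) :
  mx_generated D A -> mx_generated D (invmx A).
Proof.
move=> hA; rewrite /invmx; case: ifP => // _.
apply: mx_generatedZ; first exact/generatedV/generated_det.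
move=> i j; rewrite mxE; apply: gen_mul; first exact: generated_sign.
by apply: generated_det => k l; rewrite !mxE.
Qed.

Lemma generated_qeval n (f : quad n) x :
  mx_generated D (qmat f) -> mx_generated D (qlin f) -> generated D (qcst f) ->
  mx_generated D x -> generated D (qeval f x).
Proof.
move=> gQ gc gg gx; have gxT := mx_generated_tr gx.
apply: gen_add => //; apply: gen_add; last first.
  by apply: mx_generatedM => //; apply: mx_generated_tr.
by do 2?apply: mx_generatedM.
Qed.

End Generated.

(** * Quadratics and linear constraints along lines *)

Section Lines.
Context {F : realFieldType}.

Lemma addmxE m n (A B : 'M[F]_(m, n)) i j : (A + B) i j = A i j + B i j.
Proof. by rewrite mxE. Qed.

Lemma scalemxE m n a (A : 'M[F]_(m, n)) i j : (a *: A) i j = a * A i j.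
Proof. by rewrite mxE. Qed.

Lemma oppmxE m n (A : 'M[F]_(m, n)) i j : (- A) i j = - A i j.
Proof. by rewrite mxE. Qed.

Lemma dot_line n (a : 'rV[F]_n) (x d : 'cV[F]_n) t :
  (a *m (x + t *: d)) 0 0 = (a *m x) 0 0 + t * (a *m d) 0 0.
Proof. by rewrite mulmxDr -scalemxAr addmxE scalemxE. Qed.

(** Linear coefficient of [f] along [d] at [x]. Both cross terms are kept because [qmat f] may be
    non-symmetric. *)
Definition slope n (f : quad n) (x d : 'cV[F]_n) : F :=
  (d^T *m qmat f *m x) 0 0 + (x^T *m qmat f *m d) 0 0 + ((qlin f)^T *m d) 0 0.

Definition curvature n (f : quad n) (d : 'cV[F]_n) : F :=
  (d^T *m qmat f *m d) 0 0.

Lemma qeval_line n (f : quad n) (x d : 'cV[F]_n) t :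
  qeval f (x + t *: d) =
  qeval f x + t * slope f x d + t ^+ 2 * curvature f d.
Proof.
rewrite /qeval /slope /curvature.
have -> : (x + t *: d)^T = x^T + t *: d^T by rewrite linearD linearZ.
rewrite !(mulmxDl, mulmxDr) -!(scalemxAl, scalemxAr) !(addmxE, scalemxE); ring.
Qed.

Lemma slopeN n (f : quad n) (x d : 'cV[F]_n) : slope f x (- d) = - slope f x d.
Proof. by rewrite /slope (linearN (@trmx F n 1)) /= !(mulNmx, mulmxN) !oppmxE; ring. Qed.

Lemma curvatureN n (f : quad n) (d : 'cV[F]_n) : curvature f (- d) = curvature f d.
Proof. by rewrite /curvature (linearN (@trmx F n 1)) /= !(mulNmx, mulmxN) !oppmxE; ring. Qed.

Lemma eventually_below (c s k nu : F) :
  k < 0 \/ k = 0 /\ s < 0 ->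
  exists T0, forall T, T0 <= T -> c + T * s + T ^+ 2 * k <= nu.
Proof.
move=> H; case: H => [k0|[-> s0]].
  pose A := `|s| + `|c - nu|.
  (* The second bound gives [s + T k <= - |c - nu|]; the right side is nonpositive, so multiplying
     the left side by [T >= 1] preserves the inequality. *)
  exists (Num.max 1 (A / - k)) => T; rewrite ge_max => /andP[T1].
  rewrite ler_pdivrMr ?oppr_gt0 // => TA.
  have hs : s <= `|s| by apply: ler_norm.
  have hc : c - nu <= `|c - nu| by apply: ler_norm.
  have hc0 : 0 <= `|c - nu| by [].
  rewrite /A in TA.
  suff : T * s + T ^+ 2 * k <= - `|c - nu| by lra.
  suff : T * (s + T * k) <= - `|c - nu| by rewrite mulrDr mulrA expr2.
  have h : s + T * k <= - `|c - nu| by lra.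
  nra.
exists (`|c - nu| / - s) => T; rewrite ler_pdivrMr ?oppr_gt0 // => TA.
have hc : c - nu <= `|c - nu| by apply: ler_norm.
rewrite mulr0; lra.
Qed.

Definition descending n (f : quad n) (d : 'cV[F]_n) : Prop :=
  forall y nu, exists T0, forall T, T0 <= T -> qeval f (y + T *: d) <= nu.

(* The finite list is chosen independently of x, so that the case distinction
   on its recession directions can be made before x is known. *)
Lemma descent_directions n (f : quad n) (e : 'cV[F]_n) :
  curvature f e < 0 \/
  curvature f e = 0 /\ (exists2 s, s != 0 & forall y, slope f y e = s) ->
  exists Ds : seq 'cV[F]_n,
    [/\ {subset Ds <= [:: e; - e]},
        forall d, d \in Ds -> descending f d &
        forall x, exists2 d, d \in Ds &
          forall t, 0 <= t -> qeval f (x + t *: d) <= qeval f x].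
Proof.
case=> [k0|[k0 [s s0 hs]]].
  exists [:: e; - e]; split=> [//|d|x].
    rewrite !inE => hd y nu.
    have kd : curvature f d < 0 by case/orP: hd => /eqP->; rewrite ?curvatureN.
    have [T0 HT] := eventually_below (s := slope f y d) (qeval f y) nu (or_introl kd).
    by exists T0 => T /HT; rewrite qeval_line.
  have [sle|sgt] := lerP (slope f x e) 0.
    exists e; rewrite ?inE ?eqxx // => t t0; rewrite qeval_line; nra.
  exists (- e); rewrite ?inE ?eqxx ?orbT // => t t0.
  rewrite qeval_line slopeN curvatureN; nra.
(* With zero curvature the slope along [e] is the same nonzero constant everywhere, so a single sign
   descends from every point. *)
pose d := if s < 0 then e else - e.
have kd : curvature f d = 0 by rewrite /d; case: ifP; rewrite ?curvatureN.
have sd y : slope f y d < 0.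
  rewrite /d; case: (ltrP s 0) => s1; rewrite ?slopeN hs // oppr_lt0.
  by rewrite lt_neqAle eq_sym s0.
exists [:: d]; split=> [z|z|x].
- by rewrite !inE /d => /eqP->; case: ifP; rewrite eqxx ?orbT.
- rewrite inE => /eqP-> y nu.
  have [T0 HT] := eventually_below (qeval f y) nu (or_intror (conj kd (sd y))).
  by exists T0 => T /HT; rewrite qeval_line.
- exists d; rewrite ?inE // => t t0; rewrite qeval_line kd.
  have := sd x; nra.
Qed.

Definition tight n (q : ineq n) (x : 'cV[F]_n) : Prop := (q.1 *m x) 0 0 = q.2.

Definition recession n (P : system n) (d : 'cV[F]_n) : bool :=
  all (fun q : ineq n => (q.1 *m d) 0 0 <= 0) P.

Lemma feasible_between n (P : system n) x d (s t : F) :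
  feasible P x -> feasible P (x + t *: d) -> 0 <= s -> s <= t ->
  feasible P (x + s *: d).
Proof.
move=> /allP hx /allP ht s0 st; apply/allP => q qP.
move: (hx q qP) (ht q qP); rewrite /= !dot_line => h1 h2.
have [h|h] := lerP ((q.1 *m d) 0 0) 0; nra.
Qed.

Lemma feasible_ray n (P : system n) x d (t : F) :
  feasible P x -> recession P d -> 0 <= t -> feasible P (x + t *: d).
Proof.
move=> /allP hx /allP hd t0; apply/allP => q qP.
move: (hx q qP) (hd q qP); rewrite /= !dot_line; nra.
Qed.

(** Induction on the list: the hit [t'] on the tail is kept if [q] still holds there. Otherwise [q]
    becomes tight before [t'], at a point that is feasible by convexity. *)
Lemma ray_hit n (P : system n) x d :
  feasible P x -> ~~ recession P d ->
  exists t q, [/\ 0 <= t, q \in P, feasible P (x + t *: d) &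
                  tight q (x + t *: d)].
Proof.
elim: P => [//|q P IH] /andP[qx Px] /=.
pose t := (q.2 - (q.1 *m x) 0 0) / (q.1 *m d) 0 0.
have tE : (q.1 *m d) 0 0 != 0 -> tight q (x + t *: d).
  by move=> h; rewrite /tight dot_line /t divfK // addrC subrK.
have t0 : 0 < (q.1 *m d) 0 0 -> 0 <= t.
  by move=> h; apply: divr_ge0; rewrite ?subr_ge0 // ltW.
rewrite negb_and -ltNge; have [Pd|/IH] := boolP (recession P d).
  rewrite orbF => qd; exists t, q; have tq := tE (lt0r_neq0 qd).
  split; rewrite ?mem_head ?t0 //; apply/andP; split; first by rewrite tq.
  exact: feasible_ray (t0 _).
case=> // t' [q' [t'0 q'P Pt' tq']] _.
have [h|h] := lerP ((q.1 *m (x + t' *: d)) 0 0) q.2.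
  by exists t', q'; split; rewrite ?inE ?q'P ?orbT //; apply/andP.
have qd : 0 < (q.1 *m d) 0 0.
  rewrite ltNge; apply/negP => qd; move: h; rewrite dot_line; nra.
exists t, q; have tq := tE (lt0r_neq0 qd).
split; rewrite ?mem_head ?t0 //; apply/andP; split; first by rewrite tq.
apply: feasible_between Pt' (t0 qd) _ => //.
rewrite ler_pdivrMr //; move: h; rewrite dot_line; lra.
Qed.

Lemma segment_hit n (P : system n) x w :
  feasible P x ->
  feasible P w \/ exists t q, [/\ 0 <= t, t <= 1, q \in P,
    feasible P (x + t *: (w - x)) & tight q (x + t *: (w - x))].
Proof.
have wE : x + 1 *: (w - x) = w by rewrite scale1r addrC subrK.
move=> Px; have [Pd|Pd] := boolP (recession P (w - x)).
  by left; rewrite -wE; apply: feasible_ray.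
have [t [q [t0 qP Pt tq]]] := ray_hit Px Pd.
have [t1|t1] := lerP t 1; first by right; exists t, q.
by left; rewrite -wE; apply: feasible_between Pt _ (ltW t1).
Qed.

(** Constraints with a negative product with [d] gain unbounded slack along [d], while those
    parallel to [d] keep the slack that they have at [y]. *)
Lemma eventually_feasible n (P : system n) y d :
  recession P d -> feasible [seq q : ineq n <- P | (q.1 *m d) 0 0 == 0] y ->
  exists T0, forall T, T0 <= T -> feasible P (y + T *: d).
Proof.
elim: P => [|q P IH] /=; first by exists 0.
case/andP=> qd Pd hy.
have [|T0 HT] := IH Pd; first by move: hy; case: ifP => // _ /andP[].
move: hy; case: eqP => [qd0 /andP[qy _]|/eqP qd0 _].
  by exists T0 => T hT; apply/andP; rewrite dot_line qd0 mulr0 addr0; split; last exact: HT.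
have qdlt : (q.1 *m d) 0 0 < 0 by rewrite lt_neqAle qd0.
exists (Num.max T0 ((q.2 - (q.1 *m y) 0 0) / (q.1 *m d) 0 0)) => T.
rewrite ge_max ler_ndivrMr // => /andP[h1 h2].
apply/andP; split; last exact: HT.
by rewrite dot_line; lra.
Qed.

End Lines.

(** * Diagonalization of symmetric matrices by congruence *)

Section Diagonalization.
Context {F : realFieldType}.
Variable D : F -> Prop.

Definition diagonalizable n (Q : 'M[F]_n) : Prop :=
  exists S (l : 'rV[F]_n), [/\ S \in unitmx, mx_generated D S,
    mx_generated D l & Q = S^T *m diag_mx l *m S].

Lemma diagonalizable_congr n (Q T T' : 'M[F]_n) :
  T *m T' = 1%:M -> mx_generated D T' ->
  diagonalizable (T^T *m Q *m T) -> diagonalizable Q.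
Proof.
move=> TT' gT' [S [l [uS gS gl E]]]; exists (S *m T'), l; split=> //.
- by rewrite unitmx_mul uS; have /mulmx1_unit[] := TT'.
- exact: mx_generatedM.
rewrite trmx_mul -!mulmxA (mulmxA S^T) (mulmxA (S^T *m _)) -E.
by rewrite -!mulmxA TT' mulmx1 !mulmxA -trmx_mul TT' trmx1 mul1mx.
Qed.

(* Gaussian elimination of the first row and column; when the pivot a vanishes,
   so does r, and the junk value a^-1 = 0 is the right coefficient. *)
Lemma diagonalizable_pivot n (a : F) (r : 'rV[F]_n) (B : 'M[F]_n) :
  generated D a -> mx_generated D r -> a != 0 \/ r = 0 ->
  diagonalizable (B - a^-1 *: (r^T *m r)) ->
  diagonalizable (block_mx a%:M r r^T B : 'M_(1 + n)).
Proof.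
move=> ga gr ar [S [l [uS gS gl E]]].
exists (block_mx 1 (a^-1 *: r) 0 S), (row_mx a%:M l : 'rV_(1 + n)); split.
- by rewrite unitmxE det_ublock det1 mul1r -unitmxE.
- apply: mx_generated_block => //; [exact: mx_generated1| |exact: mx_generated0].
  by apply: mx_generatedZ => //; apply: generatedV.
- move=> i j; rewrite mxE; case: split => k; rewrite ?mxE //.
  by rewrite !ord1 eqxx.
have Ear : (a^-1 * a) *: r = r.
  case: ar => [a0|->]; last by rewrite scaler0.
  by rewrite mulVf // scale1r.
rewrite diag_mx_row tr_block_mx !mulmx_block.
have -> : diag_mx (a%:M : 'rV_1) = a%:M.
  by apply/matrixP=> i j; rewrite !mxE !ord1 eqxx.
rewrite !trmx0 !trmx1 !mul0mx !mulmx0 !mulmx1 !mul1mx ?addr0 ?add0r -E.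
rewrite mul_scalar_mx scalerA mulrC Ear linearZ /=.
rewrite mul_mx_scalar scalerA [a * _]mulrC; congr block_mx.
- by rewrite mul0mx addr0.
- by rewrite -[in LHS]Ear linearZ.
have -> : (a^-1 * a) *: r^T = r^T by rewrite -[in RHS]Ear linearZ.
by rewrite -scalemxAr addrC subrK.
Qed.

(** Lagrange reduction by induction on the dimension. The first row is eliminated if its pivot is
    nonzero or the rest of it vanishes; otherwise a shear first creates a nonzero pivot. *)
Lemma symmetric_diagonalizable n (Q : 'M[F]_n) :
  Q^T = Q -> mx_generated D Q -> diagonalizable Q.
Proof.
elim: n Q => [|n IH] Q Qsym gQ.
  exists 1%:M, 0; split; first exact: unitmx1.
  - by move=> [].
  - by move=> i [].
  - by apply/matrixP=> -[].
have pivot (R : 'M[F]_(1 + n)) : R^T = R -> mx_generated D R ->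
    R 0 0 != 0 \/ ursubmx R = 0 -> diagonalizable R.
  move=> Rsym gR hR.
  have Rul : ulsubmx R = (R 0 0)%:M.
    by rewrite [LHS]mx11_scalar !mxE; congr (R _ _)%:M; apply: val_inj.
  have Rdl : dlsubmx R = (ursubmx R)^T by rewrite -{1}Rsym trmx_ursub.
  have Rdr : (drsubmx R)^T = drsubmx R by rewrite -{2}Rsym trmx_drsub.
  have gur : mx_generated D (ursubmx R) by move=> i j; rewrite !mxE.
  rewrite -(submxK R) Rul Rdl; apply: diagonalizable_pivot => //.
  apply: IH.
    by rewrite linearB /= Rdr linearZ /= trmx_mul trmxK.
  apply: mx_generatedD; first by move=> i j; rewrite !mxE.
  apply/mx_generatedN/mx_generatedZ; first exact: generatedV.
  by apply: mx_generatedM => //; apply: mx_generated_tr.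
have [Q0|Q0] := eqVneq (Q 0 0) 0; last by apply: pivot => //; left.
have [r0|/matrix0Pn[i0 [j]]] := eqVneq (ursubmx (Q : 'M_(1 + n))) 0.
  by apply: pivot => //; right.
rewrite !mxE => Qj.
set i' := lshift _ _ in Qj; have Ei : i' = 0 by apply: val_inj; rewrite /= ord1.
rewrite {i'}Ei in Qj; set k := rshift 1 j in Qj.
have k0 : k != 0 by [].
(* As Q 0 0 = 0 and Q 0 k != 0, the quadratic form does not vanish at
   e_0 + s e_k for s = 1 or for s = -1; this vector becomes the pivot. *)
have [s [gs hs]] : exists s, generated D s /\ s * (Q 0 k + Q k 0) + s ^+ 2 * Q k k != 0.
  have EQ : Q k 0 = Q 0 k by rewrite -[in LHS]Qsym mxE.
  have [h|h] := eqVneq (1 * (Q 0 k + Q k 0) + 1 ^+ 2 * Q k k) 0.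
    exists (-1); split; first exact/gen_opp/gen_one.
    apply: contra_neq Qj => h'; move: h h'; rewrite EQ; lra.
  by exists 1; split=> //; apply: gen_one.
(* This shear sends [e_0] to [e_0 + s e_k]. As [k != 0], [delta_mx k 0] squares to zero and
   [T (- s)] inverts [T s]. *)
pose T s : 'M[F]_n.+1 := 1%:M + s *: delta_mx k 0.
have TT : T s *m T (- s) = 1%:M.
  rewrite /T !(mulmxDl, mulmxDr) !mul1mx !mulmx1 -!scalemxAl -!scalemxAr.
  by rewrite mul_delta_mx_0 1?eq_sym // !scaler0 addr0 -addrA -scalerDl addNr scale0r addr0.
have gT t : generated D t -> mx_generated D (T t).
  move=> gt; apply: mx_generatedD; first exact: mx_generated1.
  by apply: mx_generatedZ => //; apply: mx_generated_delta.
apply: (diagonalizable_congr TT); first exact/gT/gen_opp.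
apply: pivot.
- by rewrite !trmx_mul trmxK Qsym mulmxA.
- by do 2?apply: mx_generatedM => //; [apply/mx_generated_tr|]; apply: gT.
have q (X : 'M[F]_n.+1) i l :
    ((delta_mx 0 i : 'rV_n.+1) *m X *m (delta_mx l 0 : 'cV_n.+1)) 0 0 = X i l.
  by rewrite -rowE -colE !mxE.
left; suff -> : ((T s)^T *m Q *m T s) 0 0 = Q 0 0 + (s * (Q 0 k + Q k 0) + s ^+ 2 * Q k k).
  by rewrite Q0 add0r.
have -> : ((T s)^T *m Q *m T s) 0 0 = ((col 0 (T s))^T *m Q *m col 0 (T s)) 0 0.
  by rewrite -(q (_ *m T s)) colE trmx_mul trmx_delta !mulmxA.
have -> : col 0 (T s) = delta_mx 0 0 + s *: delta_mx k 0.
  rewrite colE mulmxDl mul1mx -scalemxAl mul_delta_mx //.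
have -> : (delta_mx 0 0 + s *: delta_mx k 0 : 'cV[F]_n.+1)^T = delta_mx 0 0 + s *: delta_mx 0 k.
  by rewrite linearD linearZ /= !trmx_delta.
rewrite !(mulmxDl, mulmxDr) -!(scalemxAl, scalemxAr) !(addmxE, scalemxE) !q; ring.
Qed.

End Diagonalization.

(** * Existence of decoupled forms and of hyperplane parameterizations *)

Section Existence.
Context {F : realFieldType}.

Lemma mx11_tr (A : 'M[F]_1) : A^T 0 0 = A 0 0.
Proof. by rewrite mxE. Qed.

(** Step 2 is never stuck: diagonalize the quadratic part, then complete the squares. *)
Lemma decoupled_form_exists n (f : quad (F := F) n) :
  exists S L u v g, [/\ decoupled_form f S L u v g,
    mx_generated (quad_data f) S, mx_generated (quad_data f) L,
    mx_generated (quad_data f) u &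
    mx_generated (quad_data f) v /\ generated (quad_data f) g].
Proof.
pose D := quad_data f.
have gQ : mx_generated D (qmat f).
  by move=> i j; apply: gen_data; apply: Or31; exists i, j.
have gc : mx_generated D (qlin f).
  by move=> i j; apply: gen_data; apply: Or32; exists i, j.
have g2 : generated D 2^-1 by apply/generatedV/generated_nat.
(* The symmetrized matrix defines the same quadratic form as [qmat f]. *)
pose Q := 2^-1 *: (qmat f + (qmat f)^T).
have [||S [l [uS gS gl QE]]] := @symmetric_diagonalizable F D n Q.
- by rewrite linearZ linearD /= trmxK addrC.
- by apply: mx_generatedZ => //; apply: mx_generatedD => //; apply: mx_generated_tr.
pose w := (invmx S)^T *m qlin f.
(* Centre of the completed squares in the coordinates [S x]. Division by zero yields 0, so
   coordinates with [l 0 i = 0] are not shifted and their linear terms stay in [u]. *)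
pose v' := \col_i (- (w i 0) / (2 * l 0 i)).
pose v := invmx S *m v'.
pose u := 2 *: (diag_mx l *m v') + w.
have gSV : mx_generated D (invmx S) by apply: mx_generated_inv.
have gw : mx_generated D w by apply: mx_generatedM => //; apply: mx_generated_tr.
have gL : mx_generated D (diag_mx l).
  move=> i j; rewrite mxE; case: (i == j); first exact: gl.
  exact: generated0.
have gv' : mx_generated D v'.
  move=> i j; rewrite mxE; apply: gen_mul; first exact/gen_opp.
  by apply/generatedV/gen_mul => //; apply: generated_nat.
have gv : mx_generated D v by apply: mx_generatedM.
exists S, (diag_mx l), u, v, (qeval f v); split=> //; last first.
- by split=> //; apply: generated_qeval => //; apply: gen_data; apply: Or33.
- apply: mx_generatedD => //; apply: mx_generatedZ; first exact: generated_nat.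
  exact: mx_generatedM.
split=> //.
  apply/matrixP=> i j; rewrite /u !mul_diag_mx [j]ord1.
  have Ev : v' i 0 = - w i 0 / (2 * l 0 i) by rewrite mxE.
  rewrite [LHS]mxE addmxE scalemxE [X in 2 * X]mxE Ev [RHS]mxE.
  have [->|l0] := eqVneq (l 0 i) 0; first by rewrite !mul0r.
  by field.
move=> x; set z := x - v.
have -> : x = v + 1 *: z by rewrite scale1r addrC subrK.
rewrite qeval_line expr1n !mul1r.
have half (y t : 'cV[F]_n) : (y^T *m Q *m t) 0 0 =
    2^-1 * ((t^T *m qmat f *m y) 0 0 + (y^T *m qmat f *m t) 0 0).
  rewrite -(mx11_tr (t^T *m _ *m y)) !trmx_mul trmxK mulmxA.
  by rewrite -scalemxAr -scalemxAl mulmxDr mulmxDl scalemxE addmxE addrC.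
have -> : curvature f z = (z^T *m S^T *m diag_mx l *m S *m z) 0 0.
  rewrite -(mulmxA z^T) -(mulmxA z^T) -QE half /curvature; by field.
suff -> : slope f v z = (u^T *m S *m z) 0 0 by ring.
have -> : u^T *m S = 2 *: (v^T *m Q) + (qlin f)^T.
  rewrite linearD linearZ /= !trmx_mul !trmxK tr_diag_mx mulmxDl -scalemxAl.
  by rewrite -!mulmxA (mulVmx uS) mulmx1 QE !mulmxA -(mulmxA v'^T (invmx S)^T) -trmx_mul (mulmxV uS) trmx1 mulmx1.
rewrite mulmxDl -scalemxAl addmxE scalemxE half /slope; by field.
Qed.

(** For [j] with [a 0 j != 0], the other coordinates serve as parameters, and row [j] of [M] and [p]
    solves the equation for coordinate [j]. *)
Lemma parameterizes_exists n (q : ineq (F := F) n) :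
  q.1 != 0 ->
  exists (M : 'M[F]_(n, n.-1)) p, [/\ parameterizes M p q,
    mx_generated (ineq_data q) M & mx_generated (ineq_data q) p].
Proof.
case: n q => [|n] [a b] /=; first by rewrite thinmx0 eqxx.
case/matrix0Pn=> i [j]; rewrite {i}[i]ord1 => aj.
pose D := ineq_data (a, b).
have ga i : generated D (a 0 i) by apply: gen_data; left; exists 0, i.
have gb : generated D b by apply: gen_data; right.
pose M := \matrix_(i < n.+1, k < n)
  if unlift j i is Some i' then (i' == k)%:R else - (a 0 (lift j k) / a 0 j).
pose p : 'cV[F]_n.+1 := (b / a 0 j) *: delta_mx j 0.
have Mlift z k : (M *m z + p) (lift j k) 0 = z k 0.
  rewrite !mxE (bigD1 k) //= big1 => [|l lk]; rewrite !mxE liftK.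
    by rewrite eqxx mul1r eq_sym (negPf (neq_lift j k)) mulr0 !addr0.
  by rewrite eq_sym (negPf lk) mul0r.
have Mj z : (M *m z + p) j 0 = (b - \sum_k a 0 (lift j k) * z k 0) / a 0 j.
  rewrite !mxE !eqxx mulr1 mulrBl addrC; congr (_ + _).
  rewrite mulr_suml -sumrN; apply: eq_bigr => k _; rewrite !mxE unlift_none.
  by rewrite mulNr mulrAC.
have dotE y : (a *m y) 0 0 = a 0 j * y j 0 + \sum_k a 0 (lift j k) * y (lift j k) 0.
  by rewrite mxE (bigD1_ord j).
exists M, p; split.
- split=> [z z' /= E|y /=].
    by apply/matrixP=> k l; rewrite [l]ord1 -!Mlift E.
  split=> [ay|[z ->]]; last first.
    rewrite dotE Mj mulrC divfK //.
    by under [X in _ + X]eq_bigr do rewrite Mlift; rewrite subrK.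
  exists (row' j y); apply/matrixP=> i l; rewrite [l]ord1.
  have [k ->|->] := unliftP j i; first by rewrite Mlift mxE.
  apply: (mulfI aj); rewrite Mj [RHS]mulrC divfK // -ay dotE.
  under [X in _ - X]eq_bigr do rewrite mxE.
  by rewrite addrK.
- move=> i k; rewrite mxE; case: (unlift j i) => [i'|]; first exact: generated_nat.
  by apply/gen_opp/gen_mul; last apply: generatedV.
- apply: mx_generatedZ; last exact: mx_generated_delta.
  by apply: gen_mul; last apply: generatedV.
Qed.

End Existence.

(** * Solvability of the univariate base case *)

Section BaseCase.
Context {F : realFieldType}.

Lemma seq_argmin (T : eqType) (g : T -> F) (s : seq T) :
  s != [::] -> exists2 x, x \in s & forall y, y \in s -> g x <= g y.
Proof.
elim: s => [//|x [|x' s] IH] _.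
  by exists x => [|y]; rewrite inE // => /eqP->.
have [//|z zs hz] := IH.
have [xz|/ltW zx] := lerP (g x) (g z).
  exists x => [|y]; first exact: mem_head.
  by rewrite inE => /predU1P[->//|/hz]; apply: le_trans.
exists z => [|y]; first by rewrite inE zs orbT.
by rewrite inE => /predU1P[->|/hz].
Qed.

(** Finitely many candidates decide the problem: 0, the critical point and the points where a
    constraint is tight. If some point is feasible, either a feasible ray descends to [-oo] or every
    feasible point is dominated by a feasible candidate. *)
Lemma univariate_solvable (P : system (F := F) 1) (f : quad 1) :
  all (fun q => ~~ zero_row q) P -> exists out, solves P f out.
Proof.
move=> /allP Pnz.
pose D t := system_data P t \/ quad_data f t.
pose e : 'cV[F]_1 := 1%:M.
pose k := curvature f e; pose c := qlin f 0 0.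
have eE (y : 'cV[F]_1) : y = y 0 0 *: e by rewrite scalemx1 -mx11_scalar.
have slopeE y : slope f y e = 2 * y 0 0 * k + c.
  rewrite [in LHS](eE y) /slope.
  have -> (a : F) : (a *: e)^T = a *: e^T by rewrite linearZ.
  rewrite -!(scalemxAl, scalemxAr) !scalemxE.
  by rewrite -/(curvature f e) -/k mulmx1 [(qlin f)^T 0 0]mxE -/c; ring.
(* Critical point of [f]; division by zero makes it 0 when [k = 0]. *)
pose v := (- c / (2 * k)) *: e.
pose K := 0 :: v :: [seq (q.2 / q.1 0 0) *: e | q : ineq 1 <- P].
pose K' := [seq x <- K | all (fun q : ineq 1 => (q.1 *m x) 0 0 <= q.2) P].
have tightK q y : q \in P -> tight q y -> y \in K.
  move=> qP; rewrite /tight [y in (_ *m y)]eE -scalemxAr scalemxE mulmx1 => E.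
  have q0 : q.1 0 0 != 0.
    apply: contra (Pnz q qP) => /eqP q0; rewrite /zero_row.
    by rewrite [q.1]mx11_scalar q0 raddf0.
  rewrite !inE; apply/orP; right; apply/orP; right.
  by apply/mapP; exists q => //; rewrite -E mulfK // -eE.
have genK y : y \in K -> mx_generated D y.
  have ge : mx_generated D e by apply: mx_generated1.
  have gk : generated D k.
    apply: mx_generatedM => //; apply: mx_generatedM; first exact: mx_generated_tr.
    by move=> i j; apply/gen_data; right; apply: Or31; exists i, j.
  rewrite !inE => /or3P[/eqP->|/eqP->|/mapP[q qP ->]].
  - exact: mx_generated0.
  - apply: mx_generatedZ => //; apply: gen_mul.
      by apply/gen_opp/gen_data; right; apply: Or32; exists 0, 0.
    by apply/generatedV/gen_mul => //; apply: generated_nat.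
  - have qD t : ineq_data q t -> generated D t.
      move=> qt; apply: gen_data; left; exists (index q P).
      by rewrite index_mem qP nth_index.
    apply: mx_generatedZ => //; apply: gen_mul; first by apply: qD; right.
    by apply/generatedV/qD; left; exists 0, 0.
have [K0|K0] := eqVneq K' [::].
  exists (Infeasible 1) => x Px.
  suff [y] : exists y, y \in K' by rewrite K0.
  (* The segment from [x] to 0 ends at a feasible 0 or meets a constraint; this is why 0 belongs to
     [K]. *)
  have [P0|[t [q [_ _ qP Py tq]]]] := segment_hit 0 Px.
    by exists 0; rewrite mem_filter mem_head andbT.
  by exists (x + t *: (0 - x)); rewrite mem_filter (tightK q _ qP tq) andbT; apply: Py.
have [y0 y0K' y0min] := seq_argmin (qeval f) K0.
have := y0K'; rewrite mem_filter => /andP[Py0 y0K].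
have optimal : (forall x, feasible P x -> exists2 y, y \in K' & qeval f y <= qeval f x) ->
    exists out, solves P f out.
  move=> H; exists (Optimal (qeval f y0) y0); split=> //.
  - split=> // x /H[y yK']; apply: le_trans; exact: y0min.
  - apply: generated_qeval; last exact: genK.
    + by move=> i j; apply: gen_data; right; apply: Or31; exists i, j.
    + by move=> i j; apply: gen_data; right; apply: Or32; exists i, j.
    + by apply: gen_data; right; apply: Or33.
  - exact: genK.
have [hdesc|[hk hc]] : (k < 0 \/ k = 0 /\ c != 0) \/ (0 <= k /\ (k = 0 -> c = 0)).
  have [k0|k0|k0] := ltrgtP k 0; first by left; left.
    by right; split=> [//|E]; move: k0; rewrite E ltxx.
  have [c0|c0] := eqVneq c 0; first by right; rewrite k0.
  by left; right.
- have [|Ds [_ Ddesc Dle]] := @descent_directions _ _ f e.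
    case: hdesc => [|[k0 c0]]; [by left|right; split=> //].
    by exists c => // y; rewrite slopeE k0 mulr0 add0r.
  have [/hasP[d dDs Pd]|/hasPn noPd] := boolP (has (recession P) Ds).
    exists (Unbounded 1) => nu.
    (* [descending] gives a weak bound only, hence the target [nu - 1]. *)
    have [T0 HT] := Ddesc d dDs y0 (nu - 1).
    exists (y0 + Num.max 0 T0 *: d).
      by apply: feasible_ray => //; rewrite le_max lexx.
    apply: le_lt_trans (HT _ _) _; first by rewrite le_max lexx orbT.
    by rewrite gtrBl.
  apply: optimal => x Px; have [d dDs Hd] := Dle x.
  have [t [q [t0 qP Py tq]]] := ray_hit Px (noPd d dDs).
  exists (x + t *: d); last exact: Hd.
  by rewrite mem_filter (tightK q _ qP tq) andbT; apply: Py.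
- apply: optimal => x Px.
  have le_f t : 0 <= t -> t <= 1 -> qeval f (x + t *: (v - x)) <= qeval f x.
    move=> t0 t1; pose a := - c / (2 * k) - x 0 0.
    have -> : v - x = a *: e by rewrite scalerBl -eE.
    rewrite scalerA qeval_line -/k.
    have -> : slope f x e = - (2 * a * k).
      rewrite slopeE /a; have [k0|k0] := eqVneq k 0; last by field.
      by rewrite k0 hc // !mulr0 addr0 oppr0.
    have t2 : 0 <= 2 - t by lra.
    (* With [a] the displacement from [x] to [v], the decrease of [f] is [t (2 - t) a^2 k]. *)
    rewrite -subr_ge0 [X in 0 <= X](_ : _ = t * (2 - t) * (a ^+ 2 * k)); last by ring.
    by apply: mulr_ge0; apply: mulr_ge0 => //; apply: sqr_ge0.
  have [Pv|[t [q [t0 t1 qP Py tq]]]] := segment_hit v Px.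
    exists v; first by rewrite mem_filter !inE eqxx orbT andbT; apply: Pv.
    by have := le_f 1 ler01 (lexx 1); rewrite scale1r addrC subrK.
  exists (x + t *: (v - x)); last exact: le_f.
  by rewrite mem_filter (tightK q _ qP tq) andbT; apply: Py.
Qed.

End BaseCase.

(** * Domination of feasible points by points of the branches *)

Section Descent.
Context {F : realFieldType}.

Lemma diag_curvature_ge0 n (f : quad (F := F) n) x :
  is_diag_mx (qmat f) -> (forall i, 0 <= qmat f i i) -> 0 <= curvature f x.
Proof.
move=> /is_diag_mxP Ld L0; rewrite /curvature -mulmxA mxE sumr_ge0 // => i _.
rewrite !mxE (bigD1 i) //= big1 => [|j ji]; last by rewrite Ld ?mul0r // eq_sym.
by rewrite addr0 mulrCA mulr_ge0 // -expr2 sqr_ge0.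
Qed.

Lemma mem_orthant n (h : {ffun 'I_n -> bool}) (q : ineq (F := F) n) :
  q \in orthant h -> exists i, q = ((-1) ^+ h i *: delta_mx 0 i, 0).
Proof. by case/mapP=> i _ ->; exists i. Qed.

Lemma sign_delta_dot n b (i : 'I_n) (x : 'cV[F]_n) :
  ((((-1) ^+ b) *: delta_mx 0 i : 'rV_n) *m x) 0 0 = (-1) ^+ b * x i 0.
Proof. by rewrite -scalemxAl scalemxE -rowE mxE. Qed.

Definition in_branch n (br : branch (F := F) n) (y : 'cV[F]_n) : Prop :=
  tight br.1 y /\ feasible br.2 y.

Lemma branch_of_tight n (P : system n) h q y :
  q \in P ++ orthant h -> feasible (P ++ orthant h) y -> tight q y ->
  exists2 br, br \in branches P & in_branch br y.
Proof.
set R := P ++ orthant h => qR Ry tq; pose k := index q R.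
exists (nth (0, 0) R k, take k R ++ drop k.+1 R).
  apply/flattenP; exists (facets R); first by apply/map_f; rewrite mem_enum.
  by apply/map_f; rewrite mem_iota index_mem.
split; first by rewrite /= nth_index.
apply/allP => r; rewrite mem_cat => /orP[/mem_take|/mem_drop] rR.
  exact: (allP Ry).
exact: (allP Ry).
Qed.

Lemma branch_feasible n (P : system n) br y :
  br \in branches P -> in_branch br y -> feasible P y.
Proof.
case/flattenP=> _ /mapP[h _ ->] /mapP[k]; rewrite mem_iota /= => kR ->.
set R := P ++ orthant h => -[/= tq Ry].
have : feasible R y.
  rewrite /feasible -[R in all _ R](cat_take_drop k) (drop_nth (0, 0)) //.
  rewrite all_cat /= tq lexx /=.
  by move: Ry; rewrite /feasible all_cat.
by rewrite /feasible all_cat => /andP[].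
Qed.

(** This makes every branch parameterizable: the rows added by an orthant are signed unit
    vectors. *)
Lemma branch_nonzero n (P : system (F := F) n) br :
  all (fun q => ~~ zero_row q) P -> br \in branches P -> br.1.1 != 0.
Proof.
move=> /allP Pnz; case/flattenP=> _ /mapP[h _ ->] /mapP[k].
rewrite mem_iota /= => kR -> /=.
have := mem_nth (0, 0) kR; rewrite mem_cat => /orP[/Pnz//|/mem_orthant[i ->] /=].
rewrite scaler_eq0 signr_eq0 /=; apply/eqP => /matrixP/(_ 0 i)/eqP.
by rewrite !mxE !eqxx oner_eq0.
Qed.

Lemma branch_descent n (P : system n) (f : quad n) x :
  (1 < n)%N -> is_diag_mx (qmat f) -> qmat f *m qlin f = 0 ->
  ~~ globally_solved P f -> feasible P x ->
  exists br y, [/\ br \in branches P, in_branch br y & qeval f y <= qeval f x].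
Proof.
move=> n1 Ld Lu nsol Px.
(* The orthant of [x]: a true [h i] encodes the sign -1, so it is assigned to the nonnegative
   coordinates. *)
pose h := [ffun i => 0 <= x i 0].
pose R := P ++ orthant h.
have Rx : feasible R x.
  rewrite /feasible all_cat; apply/andP; split=> //.
  apply/allP => q /mem_orthant[i ->] /=; rewrite sign_delta_dot ffunE.
  by case: (lerP 0 (x i 0)) => [x0|/ltW x0]; rewrite ?mulN1r ?oppr_le0 ?mul1r.
have finish q y : q \in R -> feasible R y -> tight q y -> qeval f y <= qeval f x ->
    exists br y, [/\ br \in branches P, in_branch br y & qeval f y <= qeval f x].
  move=> qR Ry tq le; have [br brP bry] := branch_of_tight qR Ry tq.
  by exists br, y.
(* The axes along which [f] is concave, or affine and nonconstant, and so falls to [-oo]. *)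
have finish_dir i : (qmat f i i < 0 \/ qmat f i i = 0 /\ qlin f i 0 != 0) ->
    exists br y, [/\ br \in branches P, in_branch br y & qeval f y <= qeval f x].
  move=> Hi; pose e : 'cV[F]_n := delta_mx i 0.
  have [|Ds [Dsub Ddesc Dle]] := @descent_directions _ _ f e.
    rewrite /curvature trmx_delta -rowE -colE !mxE.
    case: Hi => [|[k0 c0]]; [by left|right; split=> //].
    exists (qlin f i 0) => // y; rewrite /slope.
    have -> : e^T *m qmat f = 0.
      rewrite trmx_delta -rowE; apply/matrixP => a j; rewrite !mxE.
      by have [<-//|ij] := eqVneq i j; apply: (is_diag_mxP Ld).
    rewrite -mulmxA.
    have -> : qmat f *m e = 0.
      rewrite -colE; apply/matrixP => j a; rewrite !mxE.
      by have [->//|ij] := eqVneq j i; apply: (is_diag_mxP Ld).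
    by rewrite mul0mx mulmx0 -colE !mxE !add0r.
  have [d dDs Hd] := Dle x.
  have [Rd|Rd] := boolP (recession R d); last first.
    have [t [q [t0 qR Ry tq]]] := ray_hit Rx Rd.
    exact: finish qR Ry tq (Hd t t0).
  (* R contains a ray along the axis i.  Moving x along another axis j, until a
     constraint parallel to the ray is tight, and then far along the ray, leads
     to a point of the corresponding facet. *)
  have [j ji] : exists j, j != i.
    pose i0 := Ordinal (ltnW n1); pose i1 := Ordinal n1.
    by have [<-|] := eqVneq i0 i; [exists i1|exists i0].
  have dj : d j 0 = 0.
    have := Dsub d dDs; rewrite !inE => /orP[]/eqP->; rewrite !mxE (negPf ji) //.
    by rewrite oppr0.
  (* The sign gives [w] product 1 with the row of [qj], so the ray along [w] must meet a constraint
     of [R0]. *)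
  pose w : 'cV[F]_n := (-1) ^+ h j *: delta_mx j 0.
  pose R0 := [seq q : ineq n <- R | (q.1 *m d) 0 0 == 0].
  pose qj : ineq (F := F) n := ((-1) ^+ h j *: delta_mx 0 j, 0).
  have qjR0 : qj \in R0.
    rewrite mem_filter sign_delta_dot dj mulr0 eqxx mem_cat.
    by apply/orP; right; apply/mapP; exists j; rewrite ?mem_enum.
  have R0w : ~~ recession R0 w.
    apply/allPn; exists qj => //; rewrite sign_delta_dot !mxE !eqxx mulr1.
    by rewrite -ltNge -expr2 sqrr_sign.
  have R0x : feasible R0 x.
    by apply/allP => q; rewrite mem_filter => /andP[_]; apply: (allP Rx).
  have [t [q [t0 qR0 R0y tq]]] := ray_hit R0x R0w.
  have [T1 HT1] := eventually_feasible Rd R0y.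
  have [T2 HT2] := Ddesc d dDs (x + t *: w) (qeval f x).
  pose T := Num.max T1 T2.
  move: qR0; rewrite mem_filter => /andP[/eqP qd qR].
  apply: (finish q (x + t *: w + T *: d)) => //.
  - by apply: HT1; rewrite le_max lexx.
  - by rewrite /tight dot_line qd mulr0 addr0.
  - by apply: HT2; rewrite le_max lexx orbT.
have [/forallP Lge0|/forallPn[i]] := boolP [forall i, 0 <= qmat f i i]; last first.
  by rewrite -ltNge => Li; apply: (finish_dir i); left.
have [u0|/matrix0Pn[i [j]]] := eqVneq (qlin f) 0; last first.
  rewrite [j]ord1 => ui; apply: (finish_dir i); right; split=> //.
  (* Decoupling: the diagonal entry vanishes wherever the linear coefficient does not. *)
  have /matrixP/(_ i 0) := Lu; rewrite !mxE (bigD1 i) //= big1 => [|l li].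
    by rewrite addr0 => /eqP; rewrite mulf_eq0 (negPf ui) orbF => /eqP.
  by rewrite (is_diag_mxP Ld) ?mul0r // eq_sym.
(* Now [f] is a nonnegative combination of squares plus a constant, minimal at 0. If 0 were
   feasible, the check of Step 3 would succeed; so the segment from [x] to 0 meets a constraint. *)
have [R0|[t [q [t0 t1 qR Ry tq]]]] := segment_hit 0 Rx.
  case/negP: nsol; rewrite /globally_solved u0 eqxx /=; apply/andP; split.
    exact/forallP.
  apply/allP => q qP; have /allP/(_ q) := R0.
  by rewrite mem_cat qP mulmx0 mxE; apply.
apply: finish qR Ry tq _; rewrite qeval_line sub0r slopeN curvatureN.
have -> : slope f x x = 2 * curvature f x.
  by rewrite /slope u0 trmx0 mul0mx [X in _ + X]mxE -/(curvature f x); ring.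
have k0 := diag_curvature_ge0 x Ld Lge0.
rewrite -subr_ge0 [X in 0 <= X](_ : _ = t * (2 - t) * curvature f x); last by ring.
by apply: mulr_ge0 => //; apply: mulr_ge0 => //; lra.
Qed.

End Descent.

(** * Total correctness of the runs *)

Section Runs.
Context {F : realFieldType}.

Definition correct n (P : system n) (f : quad n) (out : output (F := F) n) : Prop :=
  match out with
  | Infeasible => is_empty (feasible P)
  | Unbounded => unbounded_below (qeval f) (feasible P)
  | Optimal val x => global_min (qeval f) (feasible P) x /\ val = qeval f x
  end.

(* Total correctness: every run from s is finite, does not get stuck, and ends
   with an output satisfying spec. *)
Inductive good n (spec : output (F := F) n -> Prop) : config n -> Prop :=
| good_return out : spec out -> good spec (Return out)
| good_step s : (exists s', step s s') ->
    (forall s', step s s' -> good spec s') -> good spec s.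

Lemma return_final n (out : output n) (s : config (F := F) n) : ~ step (Return out) s.
Proof. by move=> st; inversion st. Qed.

(** Induction on [good] gives accessibility. For progress, the reachability closure is unfolded from
    its first step, since [good] is inherited by successors. *)
Lemma good_terminates n spec (s : config (F := F) n) : good spec s -> terminates s.
Proof.
move=> gs; split.
  elim: gs => {s} [out _|s _ _ IH]; last by constructor.
  by constructor => s' /return_final.
move=> t /clos_rt_rt1n_iff st; elim: st gs => {s t} [s|s s' t st _ IH] gs.
  by case: gs => [out _|s' ? _]; [left; exists out|right].
apply: IH; case: gs st => [out _ /return_final//|s0 _ H]; exact: H.
Qed.

Lemma good_returns n spec (s : config (F := F) n) out :
  good spec s -> returns s out -> spec out.
Proof.
move=> gs /clos_rt_rt1n_iff; move E : (Return out) => t st.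
elim: st E gs => {s t} [s|s s' t st _ IH] E gs.
  rewrite -E in gs; inversion gs as [|s0 [s' st] _] => //.
  by case: (return_final st).
apply: IH => //; case: gs st => [out' _ /return_final//|s0 _ H]; exact: H.
Qed.

(** A proof rule for recursive calls: by induction on [good spec sub], the steps of the callee are
    lifted through [step4_run] until it returns and the caller resumes. *)
Lemma good_call n spec spec' S v f todo found M p (sub : config (F := F) n.-1) :
  good spec sub ->
  (forall out, spec out ->
     good spec' (Step4rec S v f todo found M p (Return out))) ->
  good spec' (Step4rec S v f todo found M p sub).
Proof.
move=> gsub Hret; elim: gsub => {sub} [//|sub [sub' st] _ IH].
apply: good_step; first by eexists; apply: step4_run st.
move=> s' st'; inversion st'; subst.
- exact: IH.
- by case: (return_final st).
- by case: (return_final st).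
- by case: (return_final st).
Qed.

Lemma feasible_subst n k (M : 'M[F]_(n, k)) p (P : system n) z :
  feasible (subst_system M p P) z <-> feasible P (M *m z + p).
Proof.
rewrite /feasible all_map; apply: eq_ind (iff_refl _) _ _; congr is_true.
by apply: eq_all => q /=; rewrite mulmxDr mulmxA addmxE lerBrDr.
Qed.

Lemma qeval_subst n k (M : 'M[F]_(n, k)) p (f : quad n) z :
  qeval (subst_quad M p f) z = qeval f (M *m z + p).
Proof.
have -> : M *m z + p = p + 1 *: (M *m z) by rewrite scale1r addrC.
rewrite qeval_line /slope /curvature /qeval /= !trmx_mul !linearD /= !trmx_mul.
rewrite !linearD /= trmxK !(mulmxDl, mulmxDr) !mulmxA !addmxE.
(* A scalar equals its transpose; this produces the cross term with [(qmat f)^T]. *)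
rewrite -(mx11_tr (z^T *m M^T *m qmat f *m p)) !trmx_mul !trmxK !mulmxA.
rewrite /qeval; ring.
Qed.

Definition after_call n S v f todo found M p (out : output n.-1) : config (F := F) n :=
  match out with
  | Infeasible => Step4 S v f todo found
  | Unbounded => Return (Unbounded n)
  | Optimal val z => Step4 S v f todo ((val, M *m z + p) :: found)
  end.

Lemma step4rec_return n S v f todo found M p out (s : config (F := F) n) :
  step (Step4rec S v f todo found M p (Return out)) s <->
  s = after_call S v f todo found M p out.
Proof.
split=> [|->]; last by case: out; constructor.
move E : (Step4rec _ _ _ _ _ _ _ _) => c st; case: st E => //.
- by move=> ? ? ? ? ? ? ? sub sub' st [_ _ _ _ _ _ _ E]; move: st; rewrite -E => /return_final.
- by move=> ? ? ? ? ? ? ? [-> -> -> -> -> -> -> ->].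
- by move=> ? ? ? ? ? ? ? [-> -> -> -> -> -> -> ->].
- by move=> ? ? ? ? ? ? ? ? ? [-> -> -> -> -> -> -> ->].
Qed.

Lemma step4_inv n S v f todo found (s : config (F := F) n) :
  step (Step4 S v f todo found) s ->
  todo = [::] /\ s = Step5 S v found \/
  exists todo1 q P todo2 M p,
    [/\ todo = todo1 ++ (q, P) :: todo2, parameterizes M p q &
      s = Step4rec S v f (todo1 ++ todo2) found M p
            (Step0 (subst_system M p P) (subst_quad M p f))].
Proof.
move E : (Step4 S v f todo found) => c st; case: st E => //.
  move=> ? ? ? todo1 q P todo2 ? M p par _ _ [-> -> -> -> ->]; right.
  by exists todo1, q, P, todo2, M, p.
by move=> ? ? ? ? [-> -> -> -> ->]; left.
Qed.

Lemma step5_inv n S v found (s : config (F := F) n) :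
  step (Step5 S v found) s ->
  found = [::] /\ s = Return (Infeasible n) \/
  exists val y, [/\ (val, y) \in found,
    all (fun r : F * 'cV[F]_n => val <= r.1) found &
    s = Return (Optimal val (invmx S *m y + v))].
Proof.
move E : (Step5 S v found) => c st; case: st E => //.
  by move=> ? ? [-> -> ->]; left.
by move=> ? ? ? val y yf ymin [-> -> ->]; right; exists val, y.
Qed.

(* The invariant of the exploration of the branches in Step 4. *)
Definition covers n (P : system n) (f : quad n) (todo : seq (branch n))
    (found : seq (F * 'cV[F]_n)) : Prop :=
  forall x, feasible P x ->
    (exists br y, [/\ br \in todo, in_branch br y & qeval f y <= qeval f x]) \/
    (exists2 r, r \in found & r.1 <= qeval f x).

Definition attained n (P : system n) (f : quad n) (found : seq (F * 'cV[F]_n)) : Prop :=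
  forall r, r \in found -> feasible P r.2 /\ r.1 = qeval f r.2.

Definition map_output n (g : 'cV[F]_n -> 'cV[F]_n) (out : output (F := F) n) : output n :=
  match out with
  | Infeasible => Infeasible n
  | Unbounded => Unbounded n
  | Optimal val x => Optimal val (g x)
  end.

(** With no open branch left, [covers] says that every value of [f] on [P] is at least some value in
    [found]: the least of these is the minimum, and an empty [found] means an empty [P]. *)
Lemma good_selection n (spec : output (F := F) n -> Prop) S v P f found :
  (forall out, correct P f out ->
    spec (map_output (fun y => invmx S *m y + v) out)) ->
  attained P f found -> covers P f [::] found ->
  good spec (Step5 S v found).
Proof.
move=> Hspec Hatt Hcov; apply: good_step.
  case: found {Hatt Hcov} => [|r0 found]; first by eexists; apply: step5_infeasible.
  have [//|[val y] rf rmin] := seq_argmin (fun r : F * 'cV[F]_n => r.1) (s := r0 :: found).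
  eexists; apply: (step5_select (val := val) S v rf).
  by apply/allP => r; apply: rmin.
move=> s /step5_inv[[E ->]|[val [y [yf ymin ->]]]]; apply: good_return.
  apply: (Hspec (Infeasible n)) => x /Hcov[[br [y [//]]]|[r]].
  by rewrite E.
apply: (Hspec (Optimal val y)).
have [Py Ey] := Hatt _ yf; split=> //; split=> // x /Hcov[[br [z [//]]]|[r rf rx]].
by rewrite -Ey /=; apply: le_trans rx; apply: (allP ymin).
Qed.

(** Induction on the number of open branches. Each recursive answer settles one: an empty branch is
    dropped, a minimum joins [found], and an unbounded branch makes [f] unbounded on [P]. *)
Lemma good_branching n (spec : output (F := F) n -> Prop) S v P f todo found :
  (forall P' f', good (correct P' f') (@Step0 F n.-1 P' f')) ->
  (forall out, correct P f out ->
    spec (map_output (fun y => invmx S *m y + v) out)) ->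
  (forall br, br \in todo -> br.1.1 != 0) ->
  (forall br y, br \in todo -> in_branch br y -> feasible P y) ->
  attained P f found -> covers P f todo found ->
  good spec (Step4 S v f todo found).
Proof.
move=> IH Hspec; have [k] := ubnP (size todo).
elim: k todo found => [//|k IHk] todo found hk Hnz Hsub Hatt Hcov.
apply: good_step.
  case: todo hk Hnz {Hsub Hcov} => [|[q R] todo] hk Hnz.
    by eexists; apply: step4_end.
  have [M [p [par gM gp]]] := parameterizes_exists (Hnz (q, R) (mem_head _ _)).
  by eexists; apply: (@step4_call _ _ _ _ _ [::] q R todo) par gM gp.
move=> s /step4_inv[[E ->]|[todo1 [q [R [todo2 [M [p [E [_ par] ->]]]]]]]].
  by apply: good_selection Hspec Hatt _; rewrite -E.
have hk' : (size (todo1 ++ todo2) < k)%N.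
  by move: hk; rewrite E !size_cat /= addnS.
have todoE br : br \in todo = (br == (q, R)) || (br \in todo1 ++ todo2).
  by rewrite E !mem_cat inE orbCA.
have sub br : br \in todo1 ++ todo2 -> br \in todo by rewrite todoE orbC => ->.
have Hnz' br : br \in todo1 ++ todo2 -> br.1.1 != 0 by move/sub/Hnz.
have Hsub' br y : br \in todo1 ++ todo2 -> in_branch br y -> feasible P y.
  by move/sub; apply: Hsub.
have inR z : feasible (subst_system M p R) z <-> in_branch (q, R) (M *m z + p).
  rewrite feasible_subst; split=> [Rz|[]//]; split=> //.
  by apply/par; exists z.
have inRP z : feasible (subst_system M p R) z -> feasible P (M *m z + p).
  by move/inR; apply: Hsub; rewrite todoE eqxx.
(* Domination through the selected branch, in the coordinates of the recursive call, is separated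
   from domination by what remains. *)
have cover x : feasible P x ->
    (exists2 z, feasible (subst_system M p R) z & qeval (subst_quad M p f) z <= qeval f x) \/
    ((exists br y, [/\ br \in todo1 ++ todo2, in_branch br y & qeval f y <= qeval f x]) \/
     (exists2 r, r \in found & r.1 <= qeval f x)).
  move/Hcov => [[br [y [brtodo bry le]]]|]; last by right; right.
  move: brtodo bry; rewrite todoE => /predU1P[->|brt] bry; last by right; left; exists br, y.
  have [z yE] := iffLR (par y) (proj1 bry); left; exists z; last by rewrite qeval_subst -yE.
  by apply/inR; rewrite -yE.
apply: good_call (IH _ _) _ => out Hout; apply: good_step.
  by eexists; apply/step4rec_return.
move=> _ /step4rec_return ->; case: out Hout => [||val z] /=.
- move=> Rempty; apply: IHk => // x /cover[[z Rz _]|//].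
  by case: (Rempty z).
- move=> Runb; apply: good_return; apply: (Hspec (Unbounded n)) => nu.
  by have [z /inRP Pz] := Runb nu; rewrite qeval_subst; exists (M *m z + p).
- case=> -[Rz zmin] valE; apply: IHk => // [r|x].
    rewrite inE => /predU1P[->|]; last exact: Hatt.
    by split; [apply: inRP|rewrite /= -qeval_subst].
  case/cover => [[z' Rz' le]|[|[r rf le]]]; [right|by left|right].
    exists (val, M *m z + p); first exact: mem_head.
    by rewrite /= valE (le_trans (zmin _ Rz')).
  by exists r; rewrite // inE rf orbT.
Qed.

Lemma good_weaken n (spec spec' : output (F := F) n -> Prop) s :
  (forall out, spec out -> spec' out) -> good spec s -> good spec' s.
Proof.
move=> H; elim=> {s} [out /H|s ex _ IH]; first exact: good_return.
exact: good_step.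
Qed.

Lemma eq_correct n (P P' : system n) f (out : output (F := F) n) :
  (forall x, feasible P x <-> feasible P' x) -> correct P f out -> correct P' f out.
Proof.
move=> PP'; case: out => [||val x] /=.
- by move=> H x /PP'/H.
- by move=> H nu; have [x /PP' Px fx] := H nu; exists x.
- by case=> -[/PP' Px xmin] ->; split=> //; split=> // y /PP'; apply: xmin.
Qed.

Lemma decoupled_evalE n (f : quad n) S L u v g (y : 'cV[F]_n) :
  decoupled_form f S L u v g -> qeval (Quad L u g) y = qeval f (invmx S *m y + v).
Proof.
case=> uS _ _ ->; rewrite addrK trmx_mul /qeval /= -!mulmxA.
by rewrite !(mulKVmx uS) !mulmxA -(mulmxA y^T (invmx S)^T) -trmx_mul (mulmxV uS) trmx1 mulmx1.
Qed.

Lemma good_Step3 n (P : system n) f S L u v g :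
  (1 < n)%N -> (forall P' f', good (correct P' f') (@Step0 F n.-1 P' f')) ->
  all (fun q => ~~ zero_row q) P -> decoupled_form f S L u v g ->
  good (correct P f) (Step3 S v (subst_system (invmx S) v P) (Quad L u g)).
Proof.
move=> n1 IH Pnz dec; have [uS dL Lu _] := dec.
set P' := subst_system _ _ _; set f' := Quad _ _ _.
have fE y : qeval f' y = qeval f (invmx S *m y + v) by apply: decoupled_evalE.
have PE y : feasible P' y <-> feasible P (invmx S *m y + v).
  exact: feasible_subst.
have invE x : invmx S *m (S *m (x - v)) + v = x by rewrite mulKmx // subrK.
have fE' x : qeval f x = qeval f' (S *m (x - v)) by rewrite fE invE.
have PE' x : feasible P x <-> feasible P' (S *m (x - v)) by rewrite PE invE.
have [sol|nsol] := boolP (globally_solved P' f').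
  apply: good_step; first by eexists; apply: step3_optimal.
  move E : (Step3 S v P' f') => c s st; case: st E => // S0 v0 P0 f0 sol0 [_ vE PE0 fE0];
    last by move: sol0; rewrite -PE0 -fE0 sol.
  subst f0 v0 P0; apply: good_return; have /and3P[/forallP L0 /eqP u0 /allP b0] := sol.
  (* The returned point [v] has coordinates [y = 0]; as [u = 0] and the diagonal is nonnegative, [g]
     bounds [f'] from below. *)
  have f0 : qeval f' 0 = g by rewrite /qeval trmx0 !mulmx0 !mxE !add0r.
  have vE : v = invmx S *m 0 + v by rewrite mulmx0 add0r.
  split; last by rewrite vE -fE f0.
  split.
    rewrite vE; apply/PE; apply/allP => q /b0.
    by rewrite mulmx0 mxE.
  move=> x _; rewrite {1}vE -fE f0 fE' /qeval.
  rewrite [qlin f']u0 trmx0 mul0mx [X in _ + X + _]mxE addr0 lerDr.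
  exact: (diag_curvature_ge0 (f := f')).
apply: good_step; first by eexists; apply: step3_branch.
move E : (Step3 S v P' f') => c s st; case: st E => // S0 v0 P0 f0 sol0 [SE vE PE0 fE0].
  by move: sol0; rewrite -PE0 -fE0 (negPf nsol).
subst S0 v0 P0 f0; apply: (@good_branching _ _ _ _ P') => //.
- case=> [||val y] /=.
  + by move=> H x /PE'/H.
  + by move=> H nu; have [y /PE Py] := H nu; rewrite fE; exists (invmx S *m y + v).
  + case=> -[/PE Py ymin] ->; rewrite -fE; split=> //; split=> // x /PE'/ymin.
    by rewrite -fE' fE.
- move=> br; apply: branch_nonzero; rewrite all_map; apply: sub_all Pnz => q /=.
  apply: contra; rewrite /zero_row /= => /eqP qS.
  by rewrite -[q.1](mulmxKV uS) qS mul0mx.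
- by move=> br y; apply: branch_feasible.
- by move=> x Px; left; apply: branch_descent.
Qed.

Lemma good_Step1 n (P : system n) f :
  (1 <= n)%N ->
  ((1 < n)%N -> forall P' f', good (correct P' f') (@Step0 F n.-1 P' f')) ->
  all (fun q => ~~ zero_row q) P -> good (correct P f) (Step1 P f).
Proof.
move=> n0 IH Pnz; have [n1|n1] := eqVneq n 1%N.
  subst n; have [out Hout] := univariate_solvable f Pnz.
  apply: good_step; first by eexists; apply: step1_base Hout.
  move=> s; move E : (Step1 P f) => c st; case: st E => // P0 f0.
  move=> out0 _ sol [PE fE]; subst P0 f0; apply: good_return.
  by case: out0 sol => //= val x [].
have n2 : (1 < n)%N by rewrite ltn_neqAle eq_sym n1.
apply: good_step; first by eexists; apply: step1_skip; apply/eqP.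
move=> s; move E : (Step1 P f) => c st; case: st E => // P0 f0.
  by move=> out /eqP n1'; case/negP: n1.
move=> _ [<- <-] {P0 f0}; apply: good_step.
  have [S [L [u [v [g [dec gS gL gu [gv gg]]]]]]] := decoupled_form_exists f.
  by eexists; apply: step2_diagonalize dec gS gL gu gv gg.
move=> {c}s; move E : (Step2 P f) => c st; case: st E => // P0 f0.
move=> S L u v g dec _ _ _ _ _ [PE fE]; subst P0 f0.
exact: good_Step3 (IH n2) Pnz dec.
Qed.

(** Induction on the dimension, which drops by one at each recursive call. A zero row reads
    [0 <= q.2]: it refutes feasibility or holds everywhere. *)
Lemma good_Step0 n (P : system (F := F) n) f : (1 <= n)%N -> good (correct P f) (Step0 P f).
Proof.
elim: n P f => [//|n IH] P f n0.
have [inf|ninf] := boolP (has (fun q : ineq n.+1 => zero_row q && (q.2 < 0)) P).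
  apply: good_step; first by eexists; apply: step0_infeasible.
  move=> s; move E : (Step0 P f) => c st; case: st E => // P0 f0 inf0 [PE _].
    apply: good_return => x /allP Px; have /hasP[q /Px] := inf.
    by move=> /[swap] /andP[/eqP->]; rewrite mul0mx mxE leNgt => ->.
  by move: inf0; rewrite -PE inf.
apply: good_step; first by eexists; apply: step0_remove.
move=> s; move E : (Step0 P f) => c st; case: st E => // P0 f0 inf0 [PE fE]; subst P0 f0.
  by move: ninf; rewrite inf0.
apply: good_weaken (good_Step1 f n0 _ _) => [out|n1 P' f'|].
- apply: eq_correct => x; split=> /allP Px; apply/allP => q qP; last first.
    by apply: Px; move: qP; rewrite mem_filter => /andP[].
  have [q0|qn0] := boolP (zero_row q); last by apply: Px; rewrite mem_filter qn0.
  rewrite (eqP q0) mul0mx mxE leNgt; have /hasPn/(_ q qP) := ninf.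
  by rewrite q0.
- exact: IH.
- exact: filter_all.
Qed.

End Runs.

Theorem theorem5p1 (F : realFieldType) (m n : nat) (n_ge1 : (1 <= n)%N)
    (A : 'M[F]_(m, n)) (b : 'cV[F]_m)
    (Q : 'M[F]_n) (Q_sym : Q^T = Q) (c : 'cV[F]_n) (gamma : F) :
  let P := polyhedron A b in
  let f := fun x : 'cV[F]_n =>
    (x^T *m Q *m x) 0 0 + (c^T *m x) 0 0 + gamma in
  let run := MinQP_LOF A b (Quad Q c gamma) in
  terminates run /\
  forall out : output n, returns run out ->
    [/\ out = Infeasible n <-> is_empty P,
        out = Unbounded n <-> unbounded_below f P,
        (exists val xs, out = Optimal val xs /\ P xs) <->
          (exists x, global_min f P x) &
        forall val xs, out = Optimal val xs ->
          P xs /\ forall x, P x -> f xs <= f x].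
Proof.
move=> P f run.
have grun : good (correct (system_of A b) (Quad Q c gamma)) run by apply: good_Step0.
split=> [|out /(good_returns grun)]; first exact: good_terminates grun.
have PE x : feasible (system_of A b) x <-> P x.
  split=> [/allP Px i|Px].
    have := Px (row i A, b i 0); rewrite /= -row_mul [row _ _ _ _]mxE; apply.
    by apply/mapP; exists i; rewrite ?mem_enum.
  by apply/allP => _ /mapP[i _ ->] /=; rewrite -row_mul mxE.
(* The three outcomes exclude one another, so the correctness of the returned one yields all the
   equivalences in both directions. *)
have not_empty x : P x -> ~ is_empty P by move=> Px /(_ x).
have not_unbounded x : global_min f P x -> ~ unbounded_below f P.
  by case=> _ xmin /(_ (f x))[y /xmin]; rewrite leNgt => /negP.
case: out => [||val x] /=.
- move=> Pempty; have P0 : is_empty P by move=> x /PE/Pempty.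
  split=> //.
  + by split=> // /(_ 0)[x /P0].
  + by split=> [[? [? []]]|[x [/P0]]].
- move=> Punb; have Pu : unbounded_below f P.
    by move=> nu; have [x /PE Px fx] := Punb nu; exists x.
  split=> //.
  + by split=> //; have [x Px _] := Pu 0; move/(not_empty x).
  + by split=> [[? [? []]]|[x /not_unbounded/(_ Pu)]].
- case=> -[/PE Px xmin] _.
  have gx : global_min f P x by split=> // y /PE/xmin.
  split=> //.
  + by split=> // /(not_empty x).
  + by split=> // /(not_unbounded x).
  + by split=> [_|_]; [exists x|exists val, x].
  + by move=> _ _ [_ <-]; case: gx.
Qed.
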